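(* Let $n\ge 3$ and let $L = sl(n,\mathbb{C}) = \{X\in\mathbb{C}^{n\times n} \mid \operatorname{tr} X = 0\}$. Let $g$ be an outer automorphism of $L$ of order $2$ (e.g. $g(X) = -X^T$), and let $L=L_0\oplus L_1$ be the associated $\mathbb{Z}_2$-grading, where $L_0=\{X: g(X)=X\}$ and $L_1=\{X : g(X)=-X\}$. Then a finite-dimensional irreducible representation $r: L\to\operatorname{End}V$ is compatible with this $\mathbb{Z}_2$-grading (i.e. there exists a decomposition $V=V_0\oplus V_1$ with $r(X_i)V_j\subseteq V_{i+j}$ for all $i,j\in\mathbb{Z}_2$ and all $X_i\in L_i$) if and only if $r$ is self-contragredient.
   Context: An automorphism of $sl(n,\mathbb{C})$ is inner if it is of the form $X\mapsto AXA^{-1}$ with $A\in SL(n,\mathbb{C})$, and outer otherwise. For a finite-dimensional representation $r$ of $sl(n,\mathbb{C})$ on $V$, the contragredient representation $r^c$ is the representation on the dual space $V^*$ given by $r^c(X) = -r(X)^T$ (transpose = dual map). The representation $r$ is called self-contragredient if $r$ is equivalent (isomorphic) to $r^c$. In terms of highest weights: the irreducible representation labelled by the Gel'fand–Tseitlin $n$-tuple $(m_{1,n}\ge m_{2,n}\ge\dots\ge m_{n,n}=0)$ has contragredient labelled by $(m_{1,n}-m_{n,n}, m_{1,n}-m_{n-1,n},\dots,m_{1,n}-m_{1,n})$, and $r$ is self-contragredient iff these two $n$-tuples coincide. *)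

(* Defs.v *)
(* The field of complex numbers is R[i] for R : realType
   (a complete archimedean ordered field, i.e. the reals up to isomorphism). *)
From HB Require Import structures.
From mathcomp Require Import all_boot all_order all_algebra.
From mathcomp Require Import complex.
From mathcomp Require Import reals.
Set Implicit Arguments. Unset Strict Implicit. Unset Printing Implicit Defensive.
Import Order.TTheory GRing.Theory Num.Theory.
Local Open Scope ring_scope.

Section Defs.
Variable F : fieldType.

Definition in_sl n (X : 'M[F]_n) : Prop := \tr X = 0.

Definition lbr n (X Y : 'M[F]_n) : 'M[F]_n := X *m Y - Y *m X.

(* a Lie algebra automorphism of sl(n) (given by a map on all matrices, only
   its restriction to sl(n) matters) *)
Definition lie_aut n (g : 'M[F]_n -> 'M[F]_n) : Prop :=
  [/\ forall X, in_sl X -> in_sl (g X),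
      forall (a : F) X Y, in_sl X -> in_sl Y -> g (a *: X + Y) = a *: g X + g Y,
      forall X Y, in_sl X -> in_sl Y -> g (lbr X Y) = lbr (g X) (g Y)
    & exists h : 'M[F]_n -> 'M[F]_n,
        (forall X, in_sl X -> in_sl (h X) /\ h (g X) = X /\ g (h X) = X)].

Definition inner_aut n (g : 'M[F]_n -> 'M[F]_n) : Prop :=
  exists A : 'M[F]_n, \det A = 1 /\
    forall X, in_sl X -> g X = A *m X *m invmx A.

Definition outer_aut_order2 n (g : 'M[F]_n -> 'M[F]_n) : Prop :=
  [/\ lie_aut g, ~ inner_aut g,
      forall X, in_sl X -> g (g X) = X
    & exists X, in_sl X /\ g X <> X].

Definition L0 n (g : 'M[F]_n -> 'M[F]_n) (X : 'M[F]_n) : Prop := in_sl X /\ g X = X.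
Definition L1 n (g : 'M[F]_n -> 'M[F]_n) (X : 'M[F]_n) : Prop := in_sl X /\ g X = - X.

Definition is_rep n m (r : 'M[F]_n -> 'M[F]_m) : Prop :=
  (forall (a : F) X Y, in_sl X -> in_sl Y -> r (a *: X + Y) = a *: r X + r Y) /\
  (forall X Y, in_sl X -> in_sl Y -> r (lbr X Y) = lbr (r X) (r Y)).

(* Subspaces of V = F^m (column vectors) are encoded by matrices U whose
   row space consists of the transposes of the vectors of the subspace.
   maps_into A U W  <->  A (as an operator on column vectors) maps the
   subspace encoded by U into the subspace encoded by W. *)
Definition maps_into m1 m2 m (A : 'M[F]_m) (U : 'M[F]_(m1, m)) (W : 'M[F]_(m2, m))
  : Prop := (U *m A^T <= W)%MS.

Definition irreducible_rep n m (r : 'M[F]_n -> 'M[F]_m) : Prop :=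
  [/\ is_rep r, (0 < m)%N &
      forall U : 'M[F]_m, (forall X, in_sl X -> maps_into (r X) U U) ->
        \rank U = 0%N \/ \rank U = m].

Definition grading_compatible n m (g : 'M[F]_n -> 'M[F]_n)
    (r : 'M[F]_n -> 'M[F]_m) : Prop :=
  exists V0 V1 : 'M[F]_m,
    [/\ (V0 + V1 :=: 1%:M)%MS, mxdirect (V0 + V1),
        (forall X, L0 g X -> maps_into (r X) V0 V0 /\ maps_into (r X) V1 V1)
      & (forall X, L1 g X -> maps_into (r X) V0 V1 /\ maps_into (r X) V1 V0)].

(* contragredient representation (matrix w.r.t. the dual basis):
   r^c(X) = - r(X)^T *)
Definition contragredient n m (r : 'M[F]_n -> 'M[F]_m) : 'M[F]_n -> 'M[F]_m :=
  fun X => - (r X)^T.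

Definition rep_equiv n m (r1 r2 : 'M[F]_n -> 'M[F]_m) : Prop :=
  exists P : 'M[F]_m, P \in unitmx /\
    forall X, in_sl X -> P *m r1 X = r2 X *m P.

Definition self_contragredient n m (r : 'M[F]_n -> 'M[F]_m) : Prop :=
  rep_equiv r (contragredient r).

End Defs.

(* Main.v *)
Require Import Defs.
From HB Require Import structures.
From mathcomp Require Import all_boot all_order all_algebra.
From mathcomp Require Import spectral.
From mathcomp Require Import complex.
From mathcomp Require Import reals.
Set Implicit Arguments.
Unset Strict Implicit.
Unset Printing Implicit Defensive.
Import Order.TTheory GRing.Theory Num.Theory.
Local Open Scope ring_scope.

(* A grading amounts to an involution T with T r(X) T^-1 = r(g X); by Schur's
   lemma any isomorphism between r o g and r can be rescaled to such a T, so the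
   theorem follows once r o g is known to be the contragredient of r for every
   outer g. Irreducible representations are determined by a highest weight.
   Hence r(X^T)^T is equivalent to r(X), because the highest weight vectors of
   the two pair nontrivially; and r o Ad(A) is equivalent to r, because A is
   conjugate to a triangular matrix, which preserves highest weight vectors.
   Finally g is itself an n-dimensional irreducible representation in which the
   root vectors E_ij, being extremal, act by matrices of rank one and square
   zero; this leaves only the highest weights of the standard representation
   (then g is inner) and of its dual (then g X = - P X^T P^-1).

   Representations are extended from sl(n) to gl(n) by letting scalars act as
   0, and act on row vectors from the right. With this convention the vectors
   killed by E_ij for j < i are the highest weight vectors. *)

(** * Representations of gl(n) and highest weight vectors *)

Lemma lbr_delta (F : fieldType) n (i j k l : 'I_n) :
  lbr (delta_mx i j) (delta_mx k l) =
  (j == k)%:R *: delta_mx i l - (l == i)%:R *: delta_mx k j :> 'M[F]_n.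
Proof.
by rewrite /lbr !mul_delta_mx_cond !scaler_nat.
Qed.

Lemma delta_mx_is_trig (F : fieldType) n (i j : 'I_n) :
  (j <= i)%N -> is_trig_mx (delta_mx i j : 'M[F]_n).
Proof.
move=> ji; apply/is_trig_mxP => a b; rewrite mxE ltnNge.
by case: eqP => [->|]; case: eqP => [->|] //; rewrite ji.
Qed.

Definition glrep (F : fieldType) n m (c : 'M[F]_n -> 'M[F]_m) :=
  linear c /\ forall X Y, c (lbr X Y) = lbr (c X) (c Y).

Definition glsimple (F : fieldType) n m (c : 'M[F]_n -> 'M[F]_m) :=
  (0 < m)%N /\ forall U : 'M_m, (forall X, U *m c X <= U)%MS ->
    (U == 0) || row_full U.

Definition glequiv (F : fieldType) n m (c d : 'M[F]_n -> 'M[F]_m) :=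
  exists2 P : 'M_m, P \in unitmx & forall X, c X *m P = P *m d X.

(** [is_trig_mx] means lower triangular. Asking for the whole Borel subalgebra, not just for matrix
    units, makes the notion easy to transport along triangular conjugations. *)
Definition hwv (F : fieldType) n m (c : 'M[F]_n -> 'M[F]_m)
    (l : 'I_n -> F) (v : 'rV_m) :=
  v != 0 /\ forall T, is_trig_mx T -> v *m c T = (\sum_i l i * T i i) *: v.

Definition upstable (F : fieldType) n m p (c : 'M[F]_n -> 'M[F]_m)
    (U : 'M_(p, m)) :=
  forall i j : 'I_n, (i < j)%N -> (U *m c (delta_mx i j) <= U)%MS.

Section Linear.
Variables (F : fieldType) (n m : nat) (c : 'M[F]_n -> 'M[F]_m).
Hypothesis cP : glrep c.

Lemma glrepD X Y : c (X + Y) = c X + c Y.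
Proof. by have [cl _] := cP; rewrite -[X in c (X + _)]scale1r cl scale1r. Qed.

Lemma glrep0 : c 0 = 0.
Proof. by apply: (addrI (c 0)); rewrite -glrepD !addr0. Qed.

Lemma glrepZ a X : c (a *: X) = a *: c X.
Proof. by have [cl _] := cP; rewrite -[_ *: X]addr0 cl glrep0 addr0. Qed.

Lemma glrepN X : c (- X) = - c X.
Proof. by rewrite -scaleN1r glrepZ scaleN1r. Qed.

Lemma glrepB X Y : c (X - Y) = c X - c Y.
Proof. by rewrite glrepD glrepN. Qed.

Lemma glrep_sum I (r : seq I) (P : pred I) (E : I -> 'M_n) :
  c (\sum_(i <- r | P i) E i) = \sum_(i <- r | P i) c (E i).
Proof. exact: (big_morph c glrepD glrep0). Qed.

Lemma glrep_deltaE X : c X = \sum_i \sum_j X i j *: c (delta_mx i j).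
Proof.
rewrite {1}[X]matrix_sum_delta glrep_sum; apply: eq_bigr => i _.
by rewrite glrep_sum; apply: eq_bigr => j _; rewrite glrepZ.
Qed.

Lemma glrep_lbr p (u : 'M_(p, m)) X Y :
  u *m c X *m c Y = u *m c Y *m c X + u *m c (lbr X Y).
Proof.
have [_ ->] := cP; rewrite /lbr mulmxBr !mulmxA.
by rewrite addrC subrK.
Qed.

Lemma hwv_delta l v : v != 0 ->
    (forall i, v *m c (delta_mx i i) = l i *: v) ->
    (forall i j : 'I_n, (j < i)%N -> v *m c (delta_mx i j) = 0) ->
  hwv c l v.
Proof.
move=> v0 vD vT; split=> // T /is_trig_mxP tT.
rewrite glrep_deltaE mulmx_sumr scaler_suml; apply: eq_bigr => i _.
rewrite mulmx_sumr (bigD1 i) //= -scalemxAr vD scalerA mulrC big1 ?addr0 //.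
move=> j; rewrite -scalemxAr neq_ltn => /orP[/vT ->|/tT->].
  by rewrite scaler0.
by rewrite scale0r.
Qed.

Lemma hwv_diag l v i : hwv c l v -> v *m c (delta_mx i i) = l i *: v.
Proof.
case=> _ -> => [|]; last exact: delta_mx_is_trig.
rewrite (bigD1 i) //= big1 ?addr0 ?mxE ?eqxx ?mulr1 // => j /negPf ji.
by rewrite mxE ji mulr0.
Qed.

Lemma hwv_low l v (i j : 'I_n) : hwv c l v -> (j < i)%N ->
  v *m c (delta_mx i j) = 0.
Proof.
move=> [_ cl] ji; rewrite cl ?delta_mx_is_trig 1?ltnW //.
rewrite big1 ?scale0r // => k _; rewrite mxE.
case: eqP => [->|_]; last by rewrite mulr0.
by rewrite -val_eqE /= (gtn_eqF ji) mulr0.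
Qed.

(* The largest submodule contained in U already contains v: for u in it and i < j,
   u c(E_ij) is again in it since [E_ij, X] acts back into U. *)
Lemma submodule_of_upstable l v (U : 'M_m) :
    hwv c l v -> (v <= U)%MS -> upstable c U ->
  exists W : 'M_m, [/\ (v <= W)%MS, (W <= U)%MS & forall X, (W *m c X <= W)%MS].
Proof.
move=> vP; elim: {U}_.+1 {-2}U (ltnSn (\rank U)) => // k IH U rkU vU upU.
(* [K (i, j)] consists of the vectors that [c (delta_mx i j)] sends into [U]. *)
pose K (p : 'I_n * 'I_n) := kermx (c (delta_mx p.1 p.2) *m cokermx U).
pose U' := (U :&: \bigcap_p K p)%MS.
have U'P q (u : 'M_(q, m)) : (u <= U)%MS -> (forall X, u *m c X <= U)%MS ->
    (u <= U')%MS.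
  move=> uU uc; rewrite sub_capmx uU; apply/sub_bigcapmxP => -[i j] _.
  by rewrite sub_kermx mulmxA -submxE.
have U'U : (U' <= U)%MS by exact: capmxSl.
have U'c X : (U' *m c X <= U)%MS.
  rewrite glrep_deltaE mulmx_sumr summx_sub // => i _.
  rewrite mulmx_sumr summx_sub // => j _; rewrite -scalemxAr scalemx_sub //.
  have: (U' <= K (i, j))%MS.
    by apply: submx_trans (capmxSr _ _) _; apply/bigcapmx_inf.
  by rewrite sub_kermx mulmxA -submxE.
have vU' : (v <= U')%MS.
  apply: U'P => // X; rewrite glrep_deltaE mulmx_sumr summx_sub // => i _.
  rewrite mulmx_sumr summx_sub // => j _; rewrite -scalemxAr scalemx_sub //.
  have [ij|ji|/val_inj ->] := ltngtP i j; last first.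
  - by rewrite (hwv_diag _ vP) scalemx_sub.
  - by rewrite (hwv_low vP) ?sub0mx.
  - exact: submx_trans (submxMr _ vU) (upU i j ij).
have upU' : upstable c U'.
  move=> i j ij; apply: U'P => [|X]; first exact: U'c.
  rewrite glrep_lbr addmx_sub //.
  exact: submx_trans (submxMr _ (U'c X)) (upU i j ij).
have [rk_eq|rk_lt] := eqVneq (\rank U') (\rank U).
  have UU' : (U <= U')%MS by rewrite -(geq_leqif (mxrank_leqif_sup U'U)) rk_eq.
  exists U; split=> // X; exact: submx_trans (submxMr _ UU') (U'c X).
have [||//|W [vW WU' Wc]] := IH U'.
- by rewrite -ltnS (leq_trans _ rkU) // ltnS ltn_neqAle rk_lt mxrankS.
- exact: vU'.
by exists W; split=> //; apply: submx_trans WU' U'U.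
Qed.

(** By simplicity, the submodule of [U] containing the nonzero vector [v] is everything. *)
Lemma upstable_full l v (U : 'M_m) : glsimple c ->
  hwv c l v -> (v <= U)%MS -> upstable c U -> row_full U.
Proof.
move=> [_ cs] vP vU /(submodule_of_upstable vP vU) [W [vW WU /cs]].
case/orP => [/eqP W0|]; last by rewrite -!sub1mx => /submx_trans ->.
by case: vP; move: vW; rewrite W0 submx0 => ->.
Qed.

End Linear.

(* Among the weights, [\sum_k k l_k] strictly decreases along the action of
   E_ij with j < i, and it is an eigenvalue of a fixed matrix. *)
Lemma hwv_exists (C : numClosedFieldType) n m (c : 'M[C]_n -> 'M[C]_m) :
  glrep c -> (0 < m)%N -> exists l v, hwv c l v.
Proof.
move=> cP m0; pose E (i j : 'I_n) : 'M[C]_n := delta_mx i j.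
pose h (l : 'I_n -> C) := \sum_(k < n) k%:R * l k.
pose wt l (v : 'rV[C]_m) := v != 0 /\ forall i, v *m c (E i i) = l i *: v.
have [l0 [v0 wt0]] : exists l v, wt l v.
  (* The diagonal units commute, so their images have a common eigenvector. *)
  have [|v v0 /allP vst] :=
      @common_eigenvector _ _ [seq c (E i i) | i <- enum 'I_n] m0.
    move=> _ _ /mapP[i _ ->] /mapP[j _ ->]; rewrite /comm_mx.
    apply/eqP; rewrite -subr_eq0; have [_ cb] := cP.
    rewrite -[_ - _]cb lbr_delta; have [->|_] := eqVneq i j.
      by rewrite subrr (glrep0 cP).
    by rewrite !scale0r subrr (glrep0 cP).
  have /fin_all_exists[l lP] (i : 'I_n) : exists a, v *m c (E i i) = a *: v.
    by apply/sub_rVP/vst/map_f; rewrite mem_enum.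
  by exists l, v.
pose H := \sum_(k < n) k%:R *: E k k.
have [s sP] := closed_field_poly_normal (char_poly (c H)).
have wtH l v : wt l v -> h l \in s.
  case=> v_neq0 vl; have: eigenvalue (c H) (h l).
    apply/eigenvalueP; exists v => //.
    rewrite (glrep_sum cP) mulmx_sumr scaler_suml; apply: eq_bigr => k _.
    by rewrite (glrepZ cP) -scalemxAr vl scalerA.
  rewrite eigenvalue_root_char sP rootZ ?root_prod_XsubC //.
  by rewrite lead_coef_eq0 monic_neq0 ?char_poly_monic.
elim: {l0}_.+1 {-2}l0 (ltnSn (count (fun x => x < h l0) s)) v0 wt0 => // k IH.
move=> l ltk v wtv; have [v_neq0 vl] := wtv.
have [/existsP[i /existsP[j /andP[ji vE]]]|] :=
  boolP [exists i : 'I_n, exists j : 'I_n, (j < i)%N && (v *m c (E i j) != 0)].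
  (* The weight of [v *m c (E i j)]: bracketing with the diagonal units takes 1 off at [i] and adds
     1 at [j], so [h] changes by [j - i < 0]. *)
  pose l' a := l a - (a == i)%:R + (a == j)%:R.
  have hl' : h l' = h l - i%:R + j%:R.
    rewrite /h /l'; under eq_bigr do rewrite mulrDr mulrBr.
    rewrite big_split sumrB /=; congr (_ - _ + _).
      by rewrite (bigD1 i) //= eqxx mulr1 big1 ?addr0 // => a /negPf->; rewrite mulr0.
    by rewrite (bigD1 j) //= eqxx mulr1 big1 ?addr0 // => a /negPf->; rewrite mulr0.
  have lt_h : h l' < h l by rewrite hl' -addrA gtrDl addrC subr_lt0 ltr_nat.
  have wt' : wt l' (v *m c (E i j)).
    split=> // a; rewrite (glrep_lbr cP) vl lbr_delta (glrepB cP) !(glrepZ cP).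
    rewrite mulmxBr -!scalemxAr -scalemxAl /l' [a == j]eq_sym.
    rewrite scalerDl scalerBl -addrA [- _ + _]addrC; congr (_ + (_ - _)).
      by have [->|_] := eqVneq j a; rewrite ?scale0r.
    by have [->|_] := eqVneq a i; rewrite ?scale0r.
  apply: (IH l' _ _ wt'); rewrite ltnS in ltk; apply: leq_trans ltk.
  (* [h l'] is a member of [s] below [h l] but not below itself, so the count drops. *)
  have /perm_to_rem/permP cnt : h l' \in s by apply: wtH wt'.
  rewrite !cnt /= ltxx lt_h ltnS sub_count // => x /lt_trans; exact.
rewrite negb_exists => /forallP vE; exists l, v; apply: hwv_delta => // i j ji.
move: (vE i); rewrite negb_exists => /forallP/(_ j).
by rewrite ji negbK => /eqP.
Qed.

(** * Intertwiners and transposed representations *)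

Lemma row_full_lker (F : fieldType) m n1 n2 (a : 'M[F]_(m, n1)) (b : 'M_(m, n2)) :
  row_full a -> (forall u : 'rV_m, u *m a = 0 -> u *m b = 0) ->
  exists P, a *m P = b.
Proof.
move=> fa ker; exists (pinvmx a *m b); apply/eqP.
rewrite -subr_eq0 mulmxA -{2}[b]mul1mx -mulmxBl.
apply/eqP/row_matrixP => i; rewrite row0 row_mul ker // -row_mul mulmxBl mul1mx.
by rewrite -mulmxA mulVpmx // mulmx1 subrr row0.
Qed.

Lemma row_full_kermx (F : fieldType) m n (A : 'M[F]_(m, n)) :
  row_full (kermx A) -> A = 0.
Proof.
by move=> fK; apply: (row_full_inj fK); rewrite mulmx_ker mulmx0.
Qed.

(** Schur's lemma: the kernel of [P] is a submodule, and it is proper. *)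
Lemma glsimple_intertwiner (F : fieldType) n m (c d : 'M[F]_n -> 'M[F]_m) P :
  glsimple c -> P != 0 -> (forall X, c X *m P = P *m d X) -> P \in unitmx.
Proof.
move=> [_ cs] P0 cP; rewrite -row_free_unit -kermx_eq0.
have /cs/orP[] // : forall X, (kermx P *m c X <= kermx P)%MS.
  by move=> X; rewrite sub_kermx -mulmxA cP mulmxA mulmx_ker mul0mx.
by move=> /row_full_kermx P_0; rewrite P_0 eqxx in P0.
Qed.

(** The contragredient of [c] composed with the Chevalley involution [X |-> - X^T]; the two signs
    cancel. *)
Definition gltr (F : fieldType) n m (c : 'M[F]_n -> 'M[F]_m) X := (c X^T)^T.

Lemma gltr_rep (F : fieldType) n m (c : 'M[F]_n -> 'M[F]_m) :
  glrep c -> glrep (gltr c).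
Proof.
move=> cP; have [cl cb] := cP; split=> [a X Y|X Y]; rewrite /gltr.
  by rewrite !linearP /= cl linearP.
rewrite /lbr linearB /= !trmx_mul -/(lbr Y^T X^T) cb /lbr linearB /=.
by rewrite !trmx_mul.
Qed.

(** The annihilator of a submodule of [gltr c] is a submodule of [c]. *)
Lemma glsimple_tr (F : fieldType) n m (c : 'M[F]_n -> 'M[F]_m) :
  glsimple c -> glsimple (gltr c).
Proof.
move=> [m0 cs]; split=> // U Uc.
have /cs : forall X, (kermx U^T *m c X <= kermx U^T)%MS.
  move=> X; have /submxP[D] := Uc X^T; rewrite /gltr trmxK => /(congr1 trmx).
  rewrite !trmx_mul trmxK => cU.
  by rewrite sub_kermx -mulmxA cU mulmxA mulmx_ker mul0mx.
rewrite kermx_eq0 row_free_unit unitmx_tr -row_full_unit => /orP[->|].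
  by rewrite orbT.
by move=> /row_full_kermx UT0; rewrite -[U]trmxK UT0 trmx0 eqxx.
Qed.

(** The hyperplane orthogonal to [w] is stable under all [c (delta_mx i j)] with [i < j]; if it
    contained [v] it would be the whole space. Equality of weights follows by evaluating
    [v c(E_ii) w^T] in two ways. *)
Lemma hwv_pairing (F : fieldType) n m (c : 'M[F]_n -> 'M[F]_m) l v l' w :
    glrep c -> glsimple c -> hwv c l v -> hwv (gltr c) l' w ->
  l =1 l' /\ v *m w^T != 0.
Proof.
move=> cP cs vP wP; have ctP := gltr_rep cP.
have wE (i j : 'I_n) : (i < j)%N -> c (delta_mx i j) *m w^T = 0.
  move=> ij; apply: trmx_inj; rewrite trmx_mul trmxK trmx0.
  by rewrite -(hwv_low wP ij) /gltr trmx_delta.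
have vw : v *m w^T != 0.
  apply/eqP => vw; have: row_full (kermx w^T).
    apply: (upstable_full cP cs vP); first by rewrite sub_kermx vw.
    by move=> i j ij; rewrite sub_kermx -mulmxA wE // mulmx0.
  by move=> /row_full_kermx w0; have [/negP[]] := wP; rewrite -[w]trmxK w0 trmx0.
split=> // i; apply/eqP; rewrite -subr_eq0.
have: (l i - l' i) *: (v *m w^T) = 0.
  rewrite scalerBl scalemxAl -(hwv_diag i vP) scalemxAr -linearZ /=.
  rewrite -(hwv_diag i wP) trmx_mul /gltr trmxK trmx_delta mulmxA.
  by rewrite subrr.
by move/eqP; rewrite scaler_eq0 (negPf vw) orbF.
Qed.

Lemma hwv_dual (C : numClosedFieldType) n m (c : 'M[C]_n -> 'M[C]_m) l v :
    glrep c -> glsimple c -> hwv c l v ->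
  exists2 p : 'cV_m, v *m p = 1%:M &
    forall i j : 'I_n, (i < j)%N -> c (delta_mx i j) *m p = 0.
Proof.
move=> cP cs vP; have [m0 _] := cs.
have [l' [w wP]] := hwv_exists (gltr_rep cP) m0.
have [_ vw] := hwv_pairing cP cs vP wP.
exists (((v *m w^T) 0 0)^-1 *: w^T).
  rewrite -scalemxAr [X in _ *: X]mx11_scalar scale_scalar_mx mulVf //.
  by apply: contra vw => /eqP vw; rewrite [v *m _]mx11_scalar vw rmorph0.
move=> i j ij; rewrite -scalemxAr; apply/eqP; rewrite scaler_eq0; apply/orP.
right; apply/eqP/trmx_inj; rewrite trmx_mul trmxK trmx0.
by rewrite -(hwv_low wP ij) /gltr trmx_delta.
Qed.

(** * Simple representations with equal highest weights *)

Definition glsum (F : fieldType) n m (c d : 'M[F]_n -> 'M[F]_m) X :=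
  block_mx (c X) 0 0 (d X).

Lemma glsum_rep (F : fieldType) n m (c d : 'M[F]_n -> 'M[F]_m) :
  glrep c -> glrep d -> glrep (glsum c d).
Proof.
move=> [cl cb] [dl db]; split=> [a X Y|X Y]; rewrite /glsum.
  by rewrite cl dl scale_block_mx add_block_mx !scaler0 !addr0.
rewrite cb db /lbr !mulmx_block opp_block_mx add_block_mx.
by rewrite !(mulmx0, mul0mx, addr0, add0r, subr0, oppr0).
Qed.

Lemma mul_row_glsum (F : fieldType) n m (c d : 'M[F]_n -> 'M[F]_m) k
    (a b : 'M_(k, m)) X :
  row_mx a b *m glsum c d X = row_mx (a *m c X) (b *m d X).
Proof. by rewrite mul_row_block !mulmx0 addr0 add0r. Qed.

Lemma hwv_sum (F : fieldType) n m (c d : 'M[F]_n -> 'M[F]_m) l v w :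
  hwv c l v -> hwv d l w -> hwv (glsum c d) l (row_mx v w).
Proof.
move=> [v0 vP] [w0 wP]; split=> [|T tT].
  by apply: contra v0 => /eqP; rewrite -row_mx0 => /eq_row_mx[->].
by rewrite mul_row_glsum vP // wP // scale_row_mx.
Qed.

(* The submodule of the sum generated by (v, w) is the graph of an
   isomorphism: it lies in the kernel of the functional (p, -q), which does not
   contain (0, w). *)
Lemma hwv_equiv (C : numClosedFieldType) n m (c d : 'M[C]_n -> 'M[C]_m) l v w :
    glrep c -> glsimple c -> glrep d -> glsimple d ->
  hwv c l v -> hwv d l w -> glequiv c d.
Proof.
move=> cP cs dP ds vP wP.
have [p vp cp] := hwv_dual cP cs vP; have [q wq dq] := hwv_dual dP ds wP.
have sP := glsum_rep cP dP; have vwP := hwv_sum vP wP.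
have [| |W [vwW WU Wc]] :=
  @submodule_of_upstable _ _ _ _ sP _ _ (kermx (col_mx p (- q))) vwP.
- by rewrite sub_kermx mul_row_col mulmxN vp wq subrr.
- move=> i j ij; rewrite sub_kermx -mulmxA mul_block_col !mul0mx mulmxN.
  by rewrite cp // dq // oppr0 !addr0 col_mx0 mulmx0.
pose a := lsubmx W; pose b := rsubmx W.
have aP X : exists2 K, a *m c X = K *m a & b *m d X = K *m b.
  have /submxP[K] := Wc X; rewrite -[W]hsubmxK mul_row_glsum mul_mx_row.
  by move/eq_row_mx=> [? ?]; exists K.
have [D vwD] := submxP vwW; rewrite -[W]hsubmxK mul_mx_row in vwD.
have [vD wD] := eq_row_mx vwD.
have fa : row_full a.
  have [_ cs'] := cs; have /cs'/orP[] X : (<<a>> *m c X <= <<a>>)%MS.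
  - have [K aK _] := aP X; rewrite (eqmxMr _ (genmxE a)) aK genmxE; exact: submxMl.
  - rewrite -mxrank_eq0 genmxE mxrank_eq0 /a => /eqP a0; have [/negP[]] := vP.
    by rewrite vD a0 mulmx0.
  - by rewrite /row_full genmxE.
have kab (u : 'rV_(m + m)) : u *m a = 0 -> u *m b = 0.
  (* [Z] spans the vectors [z] with [(0, z)] in [W], a submodule of [d]. Were it everything,
     [(0, w)] would lie in [W], on which [(p, -q)] vanishes, against [w q = 1]. *)
  pose Z := kermx a *m b => ua.
  have [_ ds'] := ds; have /ds'/orP[] X : (<<Z>> *m d X <= <<Z>>)%MS.
  - have [K aK bK] := aP X; rewrite (eqmxMr _ (genmxE Z)) genmxE -mulmxA bK mulmxA.
    by rewrite submxMr // sub_kermx -mulmxA -aK mulmxA mulmx_ker mul0mx.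
  - rewrite -mxrank_eq0 genmxE mxrank_eq0 => /eqP Z0.
    have : (u <= kermx a)%MS by rewrite sub_kermx ua.
    by case/submxP => x ->; rewrite -mulmxA -/Z Z0 mulmx0.
  rewrite /row_full genmxE => /(submx_full w)/submxP[x wx].
  have : (row_mx 0 w <= W)%MS.
    apply/submxP; exists (x *m kermx a); rewrite -[W]hsubmxK mul_mx_row.
    by rewrite -mulmxA mulmx_ker mulmx0 -mulmxA wx.
  move/submx_trans/(_ WU); rewrite sub_kermx mul_row_col mul0mx add0r mulmxN wq.
  by rewrite oppr_eq0 oner_eq0.
have [P abP] := row_full_lker fa kab.
have cPd X : c X *m P = P *m d X.
  have [K aK bK] := aP X; apply: (row_full_inj fa).
  by rewrite !mulmxA aK abP bK -mulmxA abP.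
exists P => //; apply: glsimple_intertwiner cPd => //.
have [w0 _] := wP; apply: contra w0 => /eqP P0.
by rewrite wD -/b -abP P0 !mulmx0.
Qed.

Lemma hwv_eq (F : fieldType) n m (c : 'M[F]_n -> 'M[F]_m) l l' v :
  l =1 l' -> hwv c l v -> hwv c l' v.
Proof.
move=> ll' [v0 vT]; split=> // T /vT ->.
by congr (_ *: _); apply: eq_bigr => i _; rewrite ll'.
Qed.

Lemma gltr_equiv (C : numClosedFieldType) n m (c : 'M[C]_n -> 'M[C]_m) :
  glrep c -> glsimple c -> glequiv c (gltr c).
Proof.
move=> cP cs; have [m0 _] := cs.
have [l [v vP]] := hwv_exists cP m0.
have [l' [w wP]] := hwv_exists (gltr_rep cP) m0.
have [ll' _] := hwv_pairing cP cs vP wP.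
exact: hwv_equiv cP cs (gltr_rep cP) (glsimple_tr cs) (hwv_eq ll' vP) wP.
Qed.

(** * Invariance under conjugation *)

Lemma is_trig_divr (F : fieldType) n (A T : 'M[F]_n) :
  is_trig_mx T -> T \in unitmx -> is_trig_mx (A *m T) -> is_trig_mx A.
Proof.
move=> tT; rewrite unitmxE det_trig // unitfE => /prodf_neq0 T0 /is_trig_mxP AT.
move/is_trig_mxP: tT => tT; apply/is_trig_mxP => i j.
(* Downward induction on the column: entries of [A] right of [j] vanish by induction and those of
   [T] above the diagonal by hypothesis, so [(A T)_ij = A_ij T_jj]. *)
elim: {j}(n - j)%N {-2}j (leqnn (n - j)) => [|k IH] j.
  by rewrite leqn0 subn_eq0 leqNgt ltn_ord.
move=> njk ij; move: (AT i j ij); rewrite mxE (bigD1 j) //= big1.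
  by rewrite addr0 => /eqP; rewrite mulf_eq0 (negPf (T0 j _)) // orbF => /eqP.
move=> b bj; have [bltj|jb|/val_inj /eqP] := ltngtP b j; last by rewrite (negPf bj).
  by rewrite tT // mulr0.
rewrite IH ?mul0r //; last exact: ltn_trans ij jb.
by rewrite -ltnS (leq_trans _ njk) // ltn_sub2l // (ltn_trans jb) ?ltn_ord.
Qed.

Lemma trig_mul (F : fieldType) n (S T : 'M[F]_n) : is_trig_mx S -> is_trig_mx T ->
  is_trig_mx (S *m T) /\ forall i, (S *m T) i i = S i i * T i i.
Proof.
move=> /is_trig_mxP tS /is_trig_mxP tT; split=> [|i].
  apply/is_trig_mxP => i j ij; rewrite mxE big1 // => k _.
  have [ik|ki] := ltnP i k; first by rewrite tS ?mul0r.
  by rewrite tT ?mulr0 // (leq_ltn_trans ki).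
rewrite mxE (bigD1 i) //= big1 ?addr0 // => k.
rewrite neq_ltn => /orP[ki|ik]; first by rewrite tT ?mulr0.
by rewrite tS ?mul0r.
Qed.

Lemma lbr_conj (F : fieldType) n (A X Y : 'M[F]_n) : A \in unitmx ->
  lbr (A *m X *m invmx A) (A *m Y *m invmx A) = A *m lbr X Y *m invmx A.
Proof.
by move=> Au; rewrite /lbr mulmxBr mulmxBl !mulmxA !mulmxKV.
Qed.

Lemma glconj_rep (F : fieldType) n m (c : 'M[F]_n -> 'M[F]_m) A :
  A \in unitmx -> glrep c -> glrep (fun X => c (A *m X *m invmx A)).
Proof.
move=> Au [cl cb]; split=> [a X Y|X Y].
  by rewrite mulmxDr -scalemxAr mulmxDl -scalemxAl cl.
by rewrite -lbr_conj.
Qed.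

Lemma glconj_simple (F : fieldType) n m (c : 'M[F]_n -> 'M[F]_m) A :
  A \in unitmx -> glsimple c -> glsimple (fun X => c (A *m X *m invmx A)).
Proof.
move=> Au [m0 cs]; split=> // U Uc; apply: cs => X.
by have := Uc (invmx A *m X *m A); rewrite !mulmxA mulmxV // mul1mx mulmxK.
Qed.

(** Conjugation by [T] preserves lower triangular matrices and their diagonals, so [v] keeps its
    weight in the conjugated representation. *)
Lemma glconj_trig_equiv (C : numClosedFieldType) n m (c : 'M[C]_n -> 'M[C]_m) T :
    glrep c -> glsimple c -> T \in unitmx -> is_trig_mx T ->
  glequiv c (fun X => c (T *m X *m invmx T)).
Proof.
move=> cP cs Tu tT; have [m0 _] := cs.
have [l [v vP]] := hwv_exists cP m0.
apply: (hwv_equiv cP cs (glconj_rep Tu cP) (glconj_simple Tu cs) vP (w := v)).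
have [v0 vT] := vP; split=> // S tS.
have [tTS dTS] := trig_mul tT tS.
have tS' : is_trig_mx (T *m S *m invmx T).
  by apply: (is_trig_divr tT) => //; rewrite mulmxKV.
rewrite vT //; congr (_ *: _); apply: eq_bigr => i _; congr (_ * _).
have [_ /(_ i)] := trig_mul tS' tT; rewrite mulmxKV // dTS mulrC.
move: (Tu); rewrite unitmxE det_trig // unitfE => /prodf_neq0/(_ i isT) Ti.
by move/(mulIf Ti).
Qed.

(* A triangular matrix fixes the line of a highest weight vector; writing
   A = B T B^-1 with T triangular, c o Ad(B) is unchanged by Ad(T). *)
Lemma glconj_equiv (C : numClosedFieldType) n m (c : 'M[C]_n -> 'M[C]_m) A :
    glrep c -> glsimple c -> A \in unitmx ->
  glequiv c (fun X => c (A *m X *m invmx A)).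
Proof.
move=> cP cs Au; case: n => [|n] in c A cP cs Au *.
  exists 1%:M => [|X]; first exact: unitmx1.
  by rewrite mulmx1 mul1mx [X]flatmx0 [A *m _ *m _]flatmx0.
have [P /unitarymx_unit Pu] := @Schur C n.+1 A isT.
rewrite /similar_to conjumx // => tT; set T := P *m A *m invmx P in tT.
have Tu : T \in unitmx by rewrite !unitmx_mul Pu Au unitmx_inv.
have iPu : invmx P \in unitmx by rewrite unitmx_inv.
(* This relation, evaluated at [P X P^-1], is the claim for [A = P^-1 T P]. *)
have [Q Qu QP] := glconj_trig_equiv (glconj_rep iPu cP) (glconj_simple iPu cs) Tu tT.
exists Q => // X; have := QP (P *m X *m invmx P).
have PA : P *m A = T *m P by rewrite /T mulmxKV.
have AP : invmx P *m T = A *m invmx P by rewrite /T !mulmxA mulVmx // mul1mx.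
clearbody T.
rewrite invmxK !mulmxA mulVmx // mul1mx mulmxKV // => ->; congr (_ *m c _).
apply: (can_inj (mulmxK Au)); rewrite mulmxKV // -(mulmxA _ P A) PA.
by rewrite !mulmxA mulmxKV // mulmxKV // AP mulmxKV.
Qed.

(** * Extremal matrices have rank one *)

Lemma mul_delta_mul (F : fieldType) m n p q (A : 'M[F]_(m, n)) b c
    (B : 'M_(p, q)) a d :
  (A *m delta_mx b c *m B) a d = A a b * B c d.
Proof.
have Adelta y : (A *m delta_mx b c) a y = (y == c)%:R * A a b.
  rewrite mxE (bigD1 b) //= big1 ?addr0 => [|x /negPf xb]; rewrite mxE ?xb ?mulr0 //.
  by rewrite eqxx mulrC.
rewrite mxE (bigD1 c) //= Adelta eqxx mul1r big1 ?addr0 // => y /negPf yc.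
by rewrite Adelta yc !mul0r.
Qed.

(** A matrix unit [Z] isolates the product of one entry of [A] and one of [B]. *)
Lemma mulmx_prime (F : fieldType) m n p q (A : 'M[F]_(m, n)) (B : 'M_(p, q)) :
  (forall Z, A *m Z *m B = 0) -> (A == 0) || (B == 0).
Proof.
move=> AB; apply/orP; have [_|/matrix0Pn[a [b Aab]]] := eqVneq A 0; first by left.
right; apply/eqP/matrixP => c d; have := AB (delta_mx b c).
move=> /matrixP/(_ a d); rewrite mul_delta_mul !mxE => /eqP.
by rewrite mulf_eq0 (negPf Aab) => /eqP.
Qed.

(* The powers of e are eigenvectors of ad h with distinct eigenvalues. *)
Lemma lbr_scale_nilpotent (F : numFieldType) m (h e : 'M[F]_m) :
  lbr h e = 2%:R *: e -> exists k, e ^+ k = 0.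
Proof.
move=> he; have hek k : lbr h (e ^+ k) = (2 * k)%:R *: e ^+ k.
  elim: k => [|k IH]; first by rewrite expr0 /lbr mulmx1 mul1mx subrr scale0r.
  have -> : lbr h (e ^+ k.+1) = lbr h e *m e ^+ k + e *m lbr h (e ^+ k).
    by rewrite exprS /lbr !mulmxBr !mulmxBl -!mulmxE !mulmxA addrA subrK.
  by rewrite he IH -scalemxAl -scalemxAr mulmxE -exprS -scalerDl -natrD mulnS.
pose L := lin_mulmx h - lin_mulmxr h.
have LE A : mxvec A *m L = mxvec (lbr h A).
  by rewrite mulmxBr !mul_vec_lin /= -linearB.
have [/existsP[k /eqP ek]|] := boolP [exists k : 'I_(m * m).+1, e ^+ k == 0].
  by exists k.
rewrite negb_exists => /forallP ek0.
(* If the powers up to [m * m] were all nonzero, [ad h] would have [m * m + 1] eigenvalues in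
   dimension [m * m]. *)
pose rs : seq F := [seq (2 * k)%:R | k <- iota 0 (m * m).+1].
have := max_poly_roots (monic_neq0 (char_poly_monic L)) _ _ (rs := rs).
rewrite size_char_poly size_map size_iota ltnn => H.
suff: false by []; apply: H.
  apply/allP => _ /mapP[k + ->]; rewrite mem_iota => kP.
  rewrite -eigenvalue_root_char; apply/eigenvalueP; exists (mxvec (e ^+ k)).
    by rewrite LE hek linearZ.
  by rewrite mxvec_eq0; apply: (ek0 (Ordinal kP)).
rewrite map_inj_uniq ?iota_uniq // => x y /eqP.
by rewrite eqr_nat eqn_mul2l /= => /eqP.
Qed.

(** The double bracket is [e^2 Z - 2 e Z e + Z e^2]. Once [e^2 = 0], every [e Z e] is a multiple of
    [e], and for a matrix unit [Z] it is a column times a row. *)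
Lemma extremal_rank1 (F : numFieldType) m (h e : 'M[F]_m) : e != 0 ->
    lbr h e = 2%:R *: e ->
    (forall Z, exists a, lbr e (lbr e Z) = a *: e) ->
  e *m e = 0 /\ exists (p : 'cV_m) (q : 'rV_m), e = p *m q.
Proof.
move=> e0 /lbr_scale_nilpotent ek eZ.
have eeE Z : lbr e (lbr e Z) = e *m e *m Z - 2%:R *: (e *m Z *m e) + Z *m e *m e.
  rewrite /lbr mulmxBr mulmxBl !mulmxA opprB scaler_nat mulr2n opprD !addrA.
  by rewrite addrAC; congr (_ + _); rewrite addrAC.
have ee0 : e *m e = 0.
  have nz : exists k, e ^+ k == 0 by case: ek => k /eqP; exists k.
  case: (ex_minnP nz) => k /eqP ek0 kmin.
  have [k2|] := leqP k 2.
    by rewrite mulmxE -expr2 -(subnK k2) exprD ek0 mulr0.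
  case: k ek0 kmin => // k ek0 kmin k2.
  have eke : e ^+ k *m e = 0 by rewrite mulmxE -exprSr.
  (* [e ^+ k] is now the last nonzero power; multiplying the double bracket by it on the left leaves
     only this term. *)
  have Z0 Z : e ^+ k *m Z *m (e *m e) = 0.
    have [a /(congr1 (mulmx (e ^+ k)))] := eZ Z; rewrite eeE -scalemxAr eke.
    rewrite scaler0 mulmxDr mulmxBr -scalemxAr !mulmxA eke !mul0mx.
    by rewrite scaler0 subr0 add0r.
  by case/orP: (mulmx_prime Z0) => [/kmin|/eqP //]; rewrite ltnn.
split=> //; have [a [b eab]] := matrix0Pn _ e0.
(* The [(a, b)] entry of [e Z e] is then the square of [e a b], so [x] cannot be 0. *)
have [x] := eZ (delta_mx b a).
rewrite eeE ee0 mul0mx -(mulmxA _ e e) ee0 mulmx0 addr0 sub0r => xe.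
have x0 : x != 0.
  apply: contra_neq eab => x0; move/eqP: xe.
  rewrite x0 scale0r oppr_eq0 scaler_eq0 pnatr_eq0 /= => /eqP/matrixP/(_ a b).
  by rewrite mul_delta_mul mxE => /eqP; rewrite mulf_eq0 orbb => /eqP.
exists ((- 2%:R / x) *: col b e), (row a e); rewrite colE rowE -scalemxAl.
rewrite mulmxA -(mulmxA e) mul_delta_mx.
by rewrite mulrC -scalerA scaleNr xe scalerA mulVf // scale1r.
Qed.

(** * Highest weights of n-dimensional representations *)

Lemma delta_mul_delta (F : fieldType) n (X : 'M[F]_n) i j k l :
  delta_mx i j *m X *m delta_mx k l = X j k *: delta_mx i l :> 'M_n.
Proof.
apply/matrixP => a b; rewrite -[_ *m delta_mx k l]mulmx1 mul_delta_mul.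
rewrite -[delta_mx i j]mul1mx mul_delta_mul !mxE.
by rewrite mulrAC mulrC -natrM mulnb [l == b]eq_sym.
Qed.

Lemma lbrBl (F : fieldType) n (A B C : 'M[F]_n) : lbr (A - B) C = lbr A C - lbr B C.
Proof. by rewrite /lbr mulmxBl mulmxBr !opprB addrACA [RHS]addrACA [- (B *m C) + _]addrC. Qed.

Lemma lbrC (F : fieldType) n (A B : 'M[F]_n) : lbr A B = - lbr B A.
Proof. by rewrite /lbr opprB. Qed.

Lemma lbrDscalar (F : fieldType) n (A B : 'M[F]_n) a :
  lbr A (B + a%:M) = lbr A B.
Proof.
by rewrite /lbr mulmxDl mulmxDr scalar_mxC [B *m A + _]addrC addrKA.
Qed.

Lemma lbr_coroot (F : fieldType) n (i j : 'I_n) : i != j ->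
  lbr (delta_mx i i - delta_mx j j) (delta_mx i j) = 2%:R *: delta_mx i j :> 'M[F]_n.
Proof.
move=> ij; rewrite lbrBl !lbr_delta !eqxx eq_sym (negPf ij) !scale0r !scale1r.
by rewrite subr0 sub0r opprK scaler_nat mulr2n.
Qed.

(** An automorphism of sl(n) extended by 0 reaches only traceless matrices; a scalar summand,
    invisible to brackets and invariant subspaces, restores surjectivity. *)
Definition scalar_onto (F : fieldType) n (c : 'M[F]_n -> 'M[F]_n) :=
  forall Z, exists X a, Z = c X + a%:M.

Lemma scalar_onto_simple (F : fieldType) n (c : 'M[F]_n -> 'M[F]_n) :
  (0 < n)%N -> scalar_onto c -> glsimple c.
Proof.
move=> n0 co; split=> // U Uc.
have UZ Z : (U *m Z <= U)%MS.
  by have [X [a ->]] := co Z; rewrite mulmxDr addmx_sub // mul_mx_scalar scalemx_sub.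
have [//|/matrix0Pn[a [b Uab]]] := eqVneq U 0.
rewrite -sub1mx; apply/row_subP => k.
suff -> : row k 1%:M = (U a b)^-1 *: row a (U *m delta_mx b k).
  by rewrite scalemx_sub // (submx_trans (row_sub _ _)).
apply/rowP => d; rewrite [RHS]mxE [X in _ * X]mxE -[_ *m delta_mx b k]mulmx1.
by rewrite mul_delta_mul [LHS]mxE mulKf.
Qed.

Section Classification.
Variables (F : numFieldType) (n : nat) (c : 'M[F]_n.+3 -> 'M[F]_n.+3).
Hypotheses (cP : glrep c) (co : scalar_onto c).
Hypothesis c0 : forall i j, i != j -> c (delta_mx i j) != 0.

(** [[E_ij, [E_ij, X]] = -2 X_ji E_ij], and [c] carries this to every [Z] because scalars drop out
    of brackets. *)
Lemma root_vector_rank1 i j : i != j ->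
  c (delta_mx i j) *m c (delta_mx i j) = 0 /\
  exists (p : 'cV_n.+3) (q : 'rV_n.+3), c (delta_mx i j) = p *m q.
Proof.
move=> ij; have [_ cb] := cP.
apply: (@extremal_rank1 _ _ (c (delta_mx i i - delta_mx j j))); first exact: c0.
  by rewrite -cb lbr_coroot // (glrepZ cP).
move=> Z; have [X [b ->]] := co Z.
exists (- (2%:R * X j i)).
rewrite lbrDscalar -!cb -(glrepZ cP); congr c.
rewrite /lbr mulmxBr mulmxBl !mulmxA mul_delta_mx_0 1?eq_sym // mul0mx sub0r.
rewrite -(mulmxA _ (delta_mx i j)) mul_delta_mx_0 1?eq_sym // mulmx0 subr0.
by rewrite !delta_mul_delta scaleNr -scalerA scaler_nat mulr2n opprD.
Qed.

Section Weight.
Variables (l : 'I_n.+3 -> F) (v : 'rV[F]_n.+3).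
Hypothesis vP : hwv c l v.

Lemma hwv_coroot i j :
  v *m c (delta_mx i i - delta_mx j j) = (l i - l j) *: v.
Proof. by rewrite (glrepB cP) mulmxBr !(hwv_diag _ vP) scalerBl. Qed.

Lemma lbr_opp_roots i j : i != j ->
  lbr (delta_mx i j) (delta_mx j i) = delta_mx i i - delta_mx j j :> 'M[F]_n.+3.
Proof. by move=> ij; rewrite lbr_delta !eqxx !scale1r. Qed.

Lemma hwv_raise_lower (i j : 'I_n.+3) : (i < j)%N ->
  v *m c (delta_mx i j) *m c (delta_mx j i) = (l i - l j) *: v.
Proof.
move=> ij; rewrite (glrep_lbr cP) (hwv_low vP ij) mul0mx add0r.
by rewrite lbr_opp_roots ?hwv_coroot // -val_eqE /= neq_ltn ij.
Qed.

(** Let [e], [f] be the images of [E_ij], [E_ji], and [d = l i - l j], [u = v e]. As [e^2 = 0],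
    expanding [u e f = 0] gives [(2 d - 2) u = 0], while [u f = d v]. *)
Lemma hwv_raise_eq0 (i j : 'I_n.+3) : (i < j)%N ->
  (l i - l j) = 1 \/ l i = l j /\ v *m c (delta_mx i j) = 0.
Proof.
move=> ij; have nij : i != j by rewrite -val_eqE /= neq_ltn ij.
have [ee _] := root_vector_rank1 nij.
pose d := l i - l j; pose u := v *m c (delta_mx i j).
have du : (2%:R * d - 2%:R) *: u = 0.
  have : u *m c (delta_mx i j) *m c (delta_mx j i) = 0.
    by rewrite /u -(mulmxA v) ee mulmx0 mul0mx.
  rewrite (glrep_lbr cP) hwv_raise_lower // -scalemxAl -/u -/d.
  rewrite lbr_opp_roots // /u (glrep_lbr cP) hwv_coroot -scalemxAl -/u -/d.
  rewrite lbrC lbr_coroot // (glrepN cP) (glrepZ cP) mulmxN -scalemxAr -/u.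
  by rewrite addrA -scalerDl -scalerBl -mulr2n -[d *+ 2]mulr_natl.
have [d0|d0] := eqVneq d 0.
  right; split; first by apply/eqP; rewrite -subr_eq0 -/d d0.
  move/eqP: du; rewrite d0 mulr0 sub0r scaler_eq0 oppr_eq0 pnatr_eq0 /=.
  by move/eqP.
left; apply/eqP; rewrite -/d -subr_eq0.
have : (2%:R * d - 2%:R) *: (d *: v) = 0.
  by rewrite /d -hwv_raise_lower // scalemxAl -/u -/d du mul0mx.
have [v0 _] := vP; move/eqP; rewrite !scaler_eq0 (negPf d0) (negPf v0) !orbF.
by rewrite -{2}[2%:R]mulr1 -mulrBr mulf_eq0 pnatr_eq0.
Qed.

Lemma hwv_step (i j : 'I_n.+3) : (i <= j)%N -> l i - l j = 1 \/ l i = l j.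
Proof.
rewrite leq_eqVlt => /orP[/eqP/val_inj->|/hwv_raise_eq0[|[]]]; by [right|left].
Qed.

(** Two drops by 1 would add up to 2, which [hwv_step] excludes. *)
Lemma hwv_step2 (i j k : 'I_n.+3) : (i <= j)%N -> (j <= k)%N ->
  l i = l j \/ l j = l k.
Proof.
move=> ij jk; have [lij|] := hwv_step ij; last by left.
have [ljk|] := hwv_step jk; last by right.
have lik : l i - l k = 2%:R by rewrite -(subrK (l j) (l i)) lij -addrA ljk -natr1.
have [lik1|lik0] := hwv_step (leq_trans ij jk).
  by move/eqP: lik; rewrite lik1 -[1]/1%:R eqr_nat.
by move/eqP: lik; rewrite lik0 subrr eq_sym pnatr_eq0.
Qed.

(** Otherwise the weight is constant, every root vector kills [v], and the line of [v] is a proper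
    submodule. *)
Lemma hwv_extremes : l ord0 - l ord_max = 1.
Proof.
have [//|l0m] := @hwv_step ord0 ord_max (leq0n _).
have lE i : l i = l ord0.
  by have [->|->] := @hwv_step2 ord0 i ord_max (leq0n _) (leq_ord _).
have [v0 _] := vP.
have [_ cs] := scalar_onto_simple (ltn0Sn n.+2) co.
have /cs : forall X, (<<v>> *m c X <= <<v>>)%MS.
  move=> X; rewrite (eqmxMr _ (genmxE v)) genmxE (glrep_deltaE cP).
  rewrite mulmx_sumr summx_sub // => i _; rewrite mulmx_sumr summx_sub // => j _.
  rewrite -scalemxAr scalemx_sub //; have [ij|ji|/val_inj ->] := ltngtP i j.
  - have [lij|[_ ->]] := hwv_raise_eq0 ij; last by rewrite sub0mx.
    by move/eqP: lij; rewrite !lE subrr eq_sym oner_eq0.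
  - by rewrite (hwv_low vP ji) sub0mx.
  - by rewrite (hwv_diag _ vP) scalemx_sub.
rewrite -mxrank_eq0 /row_full genmxE mxrank_eq0 (negPf v0) /= => /eqP rv.
by have := rank_leq_row v; rewrite rv.
Qed.

(* Raising by E_ij commutes with the sl2 of the roots +-(0,n-1), which
   would then have two highest weight vectors of weight 1, contradicting the
   rank one of the image of E_{0,n-1}. *)
Lemma hwv_middle (i j : 'I_n.+3) : (0 < i)%N -> (j < n.+2)%N ->
  l i = l ord0 -> l j = l ord_max -> False.
Proof.
move=> i0 jm li lj; have l0m := hwv_extremes.
have lij : l i - l j = 1 by rewrite li lj.
have ij : (i < j)%N.
  rewrite ltnNge; apply/negP => ji; move: l0m; rewrite -li -lj.
  have [lji|->] := hwv_step ji; last by rewrite subrr => /eqP; rewrite eq_sym oner_eq0.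
  rewrite -opprB lji => /eqP; rewrite eq_sym -subr_eq0 opprK.
  by rewrite -(natrD _ 1 1) pnatr_eq0.
have nij : i != j by rewrite -val_eqE /= neq_ltn ij.
have n0m : (ord0 : 'I_n.+3) != ord_max by [].
have ni0 : i != ord0 by rewrite -lt0n.
have njm : j != ord_max by rewrite -val_eqE /= neq_ltn jm.
pose v' := v *m c (delta_mx i j).
have v'0 : v' != 0.
  have [v0 _] := vP; apply: contra v0 => /eqP v'0.
  by rewrite -[v]scale1r -lij -hwv_raise_lower // -/v' v'0 mul0mx.
have [_ [p [q pq]]] := root_vector_rank1 n0m.
have vF : v *m c (delta_mx ord_max ord0) = 0 by rewrite (hwv_low vP).
have v'F : v' *m c (delta_mx ord_max ord0) = 0.
  rewrite /v' (glrep_lbr cP) vF mul0mx add0r lbr_delta (negPf njm) eq_sym (negPf ni0).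
  by rewrite !scale0r subrr (glrep0 cP) mulmx0.
pose H : 'M[F]_n.+3 := delta_mx ord0 ord0 - delta_mx ord_max ord_max.
have vH : v *m c H = v by rewrite hwv_coroot l0m scale1r.
have v'H : v' *m c H = v'.
  rewrite /v' (glrep_lbr cP) vH lbrC lbrBl !lbr_delta.
  have nj0 : j != ord0 by rewrite -lt0n (leq_trans _ ij).
  have nim : i != ord_max by rewrite -val_eqE /= neq_ltn (ltn_trans ij jm).
  rewrite (negPf njm) (negPf nj0) [_ == i]eq_sym [ord_max == i]eq_sym.
  by rewrite (negPf ni0) (negPf nim) !scale0r !subrr oppr0 (glrep0 cP) mulmx0 addr0.
pose a := (v *m p) 0 0; pose b := (v' *m p) 0 0.
have vE : v *m c (delta_mx ord0 ord_max) = a *: q.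
  by rewrite pq mulmxA [v *m p]mx11_scalar mul_scalar_mx.
have v'E : v' *m c (delta_mx ord0 ord_max) = b *: q.
  by rewrite pq mulmxA [v' *m p]mx11_scalar mul_scalar_mx.
have a0 : a != 0.
  have [v0 _] := vP; apply: contra v0 => /eqP a0.
  by rewrite -[v]scale1r -l0m -hwv_raise_lower // vE a0 scale0r mul0mx.
have vv' : a *: v' = b *: v.
  pose x := a *: v' - b *: v; apply/eqP; rewrite -subr_eq0 -/x.
  have xE : x *m c (delta_mx ord0 ord_max) = 0.
    by rewrite mulmxBl -!scalemxAl vE v'E !scalerA mulrC subrr.
  have xF : x *m c (delta_mx ord_max ord0) = 0.
    by rewrite mulmxBl -!scalemxAl vF v'F !scaler0 subrr.
  (* Both root vectors kill [x], hence so does their bracket [H], which also fixes [x]. *)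
  have <- : x *m c H = x by rewrite mulmxBl -!scalemxAl vH v'H.
  have := glrep_lbr cP x (delta_mx ord0 ord_max) (delta_mx ord_max ord0).
  by rewrite lbr_opp_roots // xE xF !mul0mx add0r => <-.
(* The coroot of [(i, j)] acts on [v] by 1 but on [v'] by [1 - 2 = -1], although the two are
   proportional. *)
have : a *: (v' *m c (delta_mx i i - delta_mx j j)) = b *: v.
  by rewrite scalemxAl vv' -scalemxAl hwv_coroot lij scale1r.
rewrite -vv' /v' (glrep_lbr cP) hwv_coroot lij scale1r lbrC lbr_coroot //.
rewrite (glrepN cP) (glrepZ cP) mulmxN -scalemxAr -/v' => /(scalerI a0).
move/eqP; rewrite -subr_eq0 addrAC subrr sub0r oppr_eq0 scaler_eq0 pnatr_eq0.
by rewrite (negPf v'0).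
Qed.

(** The weight drops exactly once, by 1; [hwv_middle] forces the drop to the first or the last
    step. *)
Lemma hwv_standard_or_dual :
  (forall i, l i = (i == ord0)%:R + l ord_max) \/
  (forall i, l i = l ord0 - (i == ord_max)%:R).
Proof.
have l0m : l ord0 = 1 + l ord_max by rewrite -hwv_extremes subrK.
have lm0 : l ord_max = l ord0 - 1 by rewrite l0m addrC addKr.
pose i1 : 'I_n.+3 := Ordinal (isT : 1 < n.+3)%N.
(* The last index but one; it equals [i1] for 3 by 3 matrices. *)
pose ip : 'I_n.+3 := Ordinal (leqnSn n.+2 : n.+1 < n.+3)%N.
have [l1|l1] := @hwv_step2 ord0 i1 ord_max (leq0n _) (leq_ord _); last first.
  left=> i; have [->|i0] := eqVneq i ord0; first by rewrite l0m.
  rewrite add0r; have i1i : (i1 <= i)%N by rewrite lt0n.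
  have [<-|//] := @hwv_step2 i1 i ord_max i1i (leq_ord _); exact: l1.
have [lp|lp] := @hwv_step2 ord0 ip ord_max (leq0n _) (leq_ord _).
  right=> i; have [->|im] := eqVneq i ord_max; first by rewrite lm0.
  rewrite subr0; have iip : (i <= ip)%N.
    by rewrite -ltnS ltn_neqAle -ltnS ltn_ord andbT.
  by have [->|->] := @hwv_step2 ord0 i ip (leq0n _) iip.
by case: (@hwv_middle i1 ip) => //=.
Qed.

End Weight.
End Classification.

(** * The standard representation, its dual, and trace twists *)

Lemma mxtrace_lbr (F : fieldType) n (X Y : 'M[F]_n) : \tr (lbr X Y) = 0.
Proof. by rewrite /lbr linearB /= mxtrace_mulC subrr. Qed.

(* The twist leaves c unchanged on sl(n) and moves the weight by a constant. *)
Lemma glrep_twist (F : fieldType) n (a : F) (c : 'M[F]_n -> 'M[F]_n) :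
  glrep c -> glrep (fun X => c X + (a * \tr X)%:M).
Proof.
move=> [cl cb]; split=> [b X Y|X Y].
  rewrite cl linearP /= mulrDr mulrCA raddfD /= -!scale_scalar_mx.
  by rewrite scalerDr addrACA.
by rewrite cb mxtrace_lbr mulr0 raddf0 addr0 lbrDscalar [RHS]lbrC lbrDscalar -lbrC.
Qed.

Lemma hwv_twist (F : fieldType) n (a : F) (c : 'M[F]_n -> 'M[F]_n) l v :
  hwv c l v -> hwv (fun X => c X + (a * \tr X)%:M) (fun i => l i + a) v.
Proof.
move=> [v0 vP]; split=> // T /vP vT.
rewrite mulmxDr vT mul_mx_scalar -scalerDl; congr (_ *: _).
by rewrite mulr_sumr -big_split; apply: eq_bigr => i _; rewrite mulrDl.
Qed.

Lemma glrep_id (F : fieldType) n : glrep (id : 'M[F]_n -> 'M_n).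
Proof. by []. Qed.

Lemma hwv_standard (F : fieldType) n :
  hwv (id : 'M[F]_n.+1 -> 'M_n.+1) (fun i => (i == ord0)%:R) (delta_mx 0 ord0).
Proof.
apply: hwv_delta => //.
- by apply/matrix0Pn; exists 0, ord0; rewrite mxE !eqxx oner_eq0.
- move=> i; rewrite mul_delta_mx_cond eq_sym; case: eqP => [->|_].
    by rewrite scale1r.
  by rewrite scale0r.
- by move=> i j ji; rewrite mul_delta_mx_0 // -val_eqE /= neq_ltn (leq_trans _ ji).
Qed.

Lemma glrep_opp_tr (F : fieldType) n : glrep (fun X : 'M[F]_n => - X^T).
Proof.
split=> [a X Y|X Y]; first by rewrite linearP opprD scalerN.
by rewrite /lbr !mulNmx !mulmxN !opprK linearB /= !trmx_mul opprB.
Qed.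

Lemma hwv_dual_standard (F : fieldType) n :
  hwv (fun X : 'M[F]_n.+1 => - X^T) (fun i => - (i == ord_max)%:R)
    (delta_mx 0 ord_max).
Proof.
apply: (hwv_delta (glrep_opp_tr F n.+1)).
- by apply/matrix0Pn; exists 0, ord_max; rewrite mxE !eqxx oner_eq0.
- move=> i; rewrite trmx_delta mulmxN mul_delta_mx_cond eq_sym scaleNr.
  by case: eqP => [->|_]; rewrite ?scale1r ?scale0r.
- move=> i j ji; rewrite trmx_delta mulmxN mul_delta_mx_0 ?oppr0 //.
  by rewrite -val_eqE /= neq_ltn (leq_trans ji (leq_ord i)) orbT.
Qed.

Lemma scalar_onto_twist (F : fieldType) n (a : F) (c : 'M[F]_n -> 'M[F]_n) :
  (forall Z, exists X, c X = Z) -> scalar_onto (fun X => c X + (a * \tr X)%:M).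
Proof.
move=> co Z; have [X <-] := co Z; exists X, (- (a * \tr X)).
by rewrite raddfN /= addrK.
Qed.

(** Weights are known only up to a constant, which a multiple of the trace absorbs without any
    effect on sl(n). *)
Lemma natural_rep_classification (C : numClosedFieldType) n
    (c : 'M[C]_n.+3 -> 'M[C]_n.+3) :
    glrep c -> scalar_onto c -> (forall i j, i != j -> c (delta_mx i j) != 0) ->
  exists2 P, P \in unitmx &
    (forall X, in_sl X -> c X *m P = P *m X) \/
    (forall X, in_sl X -> c X *m P = P *m - X^T).
Proof.
move=> cP co c0; have [l [v vP]] := hwv_exists cP (ltn0Sn n.+2).
have cs := scalar_onto_simple (ltn0Sn n.+2) co.
have [lE|lE] := hwv_standard_or_dual cP co c0 vP.
  have idS (Z : 'M[C]_n.+3) : exists X, id X = Z by exists Z.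
  have [P Pu cPd] := hwv_equiv cP cs (glrep_twist (l ord_max) (glrep_id C n.+3))
    (scalar_onto_simple (ltn0Sn n.+2) (scalar_onto_twist (l ord_max) idS))
    (hwv_eq lE vP) (hwv_twist (l ord_max) (hwv_standard C n.+2)).
  by exists P => //; left=> X X0; rewrite cPd X0 mulr0 raddf0 addr0.
have trS (Z : 'M[C]_n.+3) : exists X, (fun X => - X^T) X = Z.
  by exists (- Z^T); rewrite linearN /= opprK trmxK.
have lE' i : l i = - (i == ord_max)%:R + l ord0 by rewrite addrC lE.
have [P Pu cPd] := hwv_equiv cP cs (glrep_twist (l ord0) (glrep_opp_tr C n.+3))
  (scalar_onto_simple (ltn0Sn n.+2) (scalar_onto_twist (l ord0) trS))
  (hwv_eq lE' vP) (hwv_twist (l ord0) (hwv_dual_standard C n.+2)).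
by exists P => //; right=> X X0; rewrite cPd X0 mulr0 raddf0 addr0.
Qed.

(** * Outer automorphisms of sl(n) *)

Definition slproj (F : fieldType) n (X : 'M[F]_n) := X - (\tr X / n%:R)%:M.

Lemma slproj_id (F : fieldType) n (X : 'M[F]_n) : in_sl X -> slproj X = X.
Proof. by move=> X0; rewrite /slproj X0 mul0r raddf0 subr0. Qed.

Lemma in_sl_slproj (F : numFieldType) n (X : 'M[F]_n) : (0 < n)%N -> in_sl (slproj X).
Proof.
move=> n0; rewrite /in_sl /slproj linearB /= mxtrace_scalar -[_ *+ n]mulr_natr.
by rewrite divfK ?subrr // pnatr_eq0 -lt0n.
Qed.

Lemma slext_rep (F : numFieldType) n m (r : 'M[F]_n -> 'M[F]_m) : (0 < n)%N ->
  is_rep r -> glrep (r \o @slproj F n).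
Proof.
move=> n0 [rl rb]; have sS X := @in_sl_slproj F n X n0.
split=> [a X Y|X Y] /=.
  rewrite -rl //; congr r; rewrite /slproj linearP /= mulrDl -mulrA.
  by rewrite raddfD /= -scale_scalar_mx opprD scalerBr addrACA.
rewrite slproj_id; last exact: mxtrace_lbr.
rewrite -rb //; congr r; rewrite /slproj -!raddfN /=.
by rewrite lbrDscalar [RHS]lbrC lbrDscalar -lbrC.
Qed.

Lemma contragredient_rep (F : fieldType) n m (r : 'M[F]_n -> 'M[F]_m) :
  is_rep r -> is_rep (contragredient r).
Proof.
move=> [rl rb]; rewrite /contragredient; split=> [a X Y sX sY|X Y sX sY].
  by rewrite rl // linearP opprD scalerN.
by rewrite rb // /lbr !mulNmx !mulmxN !opprK linearB /= !trmx_mul opprB.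
Qed.

(** Rescaling [P] does not change the conjugation, and an n-th root of [(\det P)^-1] brings the
    determinant to 1. *)
Lemma inner_aut_unit (C : numClosedFieldType) n (g : 'M[C]_n -> 'M[C]_n) P :
    (0 < n)%N -> P \in unitmx -> (forall X, in_sl X -> g X *m P = P *m X) ->
  inner_aut g.
Proof.
move=> n0 Pu gP; have dP : \det P != 0 by rewrite -unitfE -unitmxE.
pose a := n.-root (\det P)^-1.
have an : a ^+ n = (\det P)^-1 by rewrite rootCK.
have a0 : a != 0 by rewrite rootC_eq0 // invr_eq0.
exists (a *: P); split; first by rewrite detZ an mulVf.
move=> X /gP gX; rewrite invmxZ ?unitfE //; last by rewrite unitmxZ ?unitfE.
by rewrite -!scalemxAl -scalemxAr scalerA divff // scale1r -gX mulmxK.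
Qed.

Lemma outer_aut_classification (C : numClosedFieldType) n
    (g : 'M[C]_n -> 'M[C]_n) :
    (3 <= n)%N -> lie_aut g -> ~ inner_aut g ->
  exists2 P, P \in unitmx & forall X, in_sl X -> g X *m P = P *m - X^T.
Proof.
case: n g => [|[|[|n]]] // g _ [gs gl gb [h hP]] go.
have gP : glrep (g \o @slproj C n.+3) by apply: slext_rep.
have gE X : in_sl X -> (g \o @slproj C n.+3) X = g X.
  by move=> sX /=; rewrite slproj_id.
have [||P Pu [gX|gX]] := natural_rep_classification gP.
- move=> Z; have [sh [_ gh]] := hP _ (in_sl_slproj Z (ltn0Sn n.+2)).
  by exists (h (slproj Z)), (\tr Z / n.+3%:R); rewrite gE // gh subrK.
- move=> i j ij; have sE : in_sl (delta_mx i j : 'M[C]_n.+3).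
    rewrite /in_sl /mxtrace big1 // => k _; rewrite mxE.
    by have [->|//] := eqVneq k i; rewrite (negPf ij).
  rewrite gE //; apply/eqP => g0; have [_ [hE _]] := hP _ sE.
  have [_ [h0 _]] := hP 0 (linear0 _).
  have : delta_mx i j = 0 :> 'M[C]_n.+3.
    by rewrite -hE g0 -{2}h0 -(gE 0 (linear0 _)) (glrep0 gP).
  by move/matrixP/(_ i j)/eqP; rewrite !mxE !eqxx oner_eq0.
- by case: go; apply: (@inner_aut_unit _ _ _ P) => // X sX; rewrite -gE // gX.
- by exists P => // X sX; rewrite -gE // gX.
Qed.

(** For [c] the contragredient of [r], [c (- X^T)] is equivalent to [r X] through [gltr_equiv], and
    to [c (g X) = - (r (g X))^T] through [glconj_equiv]; transposing the resulting equivalence gives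
    the claim. *)
Lemma outer_twist_contragredient (C : numClosedFieldType) n m
    (g : 'M[C]_n -> 'M[C]_n) (r : 'M[C]_n -> 'M[C]_m) :
    (3 <= n)%N -> lie_aut g -> ~ inner_aut g -> irreducible_rep r ->
  rep_equiv (r \o g) (contragredient r).
Proof.
move=> n3 ga go [rP m0 rs]; have n0 : (0 < n)%N by apply: leq_trans n3.
have [gs _ _ _] := ga; have [P Pu gP] := outer_aut_classification n3 ga go.
pose c := contragredient r \o @slproj C n.
have cP : glrep c by apply/slext_rep/contragredient_rep.
have cE X : in_sl X -> c X = - (r X)^T.
  by move=> sX; rewrite /c /= slproj_id.
(* Up to sign, the row action of [c] is the encoding of [r] in [maps_into]. *)
have cs : glsimple c.
  split=> // U Uc; rewrite -mxrank_eq0 /row_full.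
  have [X sX|->|->] := rs U; rewrite ?eqxx ?orbT //.
  by have := Uc X; rewrite cE // mulmxN eqmx_opp.
have [Q Qu QP] := glconj_equiv cP cs Pu; have [S Su SP] := gltr_equiv cP cs.
exists (invmx Q *m S)^T; rewrite unitmx_tr unitmx_mul unitmx_inv Qu; split=> // X sX.
have gX : g X = P *m - X^T *m invmx P by rewrite -gP // mulmxK.
have cQ : - (c (- X^T) *m Q) = Q *m (r (g X))^T.
  by rewrite QP -gX (cE _ (gs _ sX)) mulmxN opprK.
have cS : c (- X^T) *m S = S *m r X.
  rewrite SP /gltr; have -> : (- X^T)^T = - X by rewrite linearN /= trmxK.
  by rewrite (glrepN cP) cE // opprK trmxK.
apply: trmx_inj; rewrite /contragredient !trmx_mul !trmxK linearN /= trmxK mulmxN.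
apply: (can_inj (mulKmx Qu)); rewrite mulmxN !mulmxA -cQ mulmxV // mul1mx.
by rewrite mulNmx mulmxK // mulNmx cS.
Qed.

(** * Gradings and involutive intertwiners *)

Lemma twist_equiv_self_contragredient (F : fieldType) n m
    (g : 'M[F]_n -> 'M[F]_n) (r : 'M[F]_n -> 'M[F]_m) :
    rep_equiv (r \o g) (contragredient r) ->
  rep_equiv (r \o g) r <-> self_contragredient r.
Proof.
move=> [P [Pu rP]]; split=> [[T [Tu rT]]|[T [Tu rT]]].
  exists (P *m invmx T); rewrite unitmx_mul Pu unitmx_inv; split=> // X sX.
  apply: (can_inj (mulmxK Tu)); rewrite -!mulmxA -rT // mulKmx // mulVmx // mulmx1.
  exact: rP.
exists (invmx T *m P); rewrite unitmx_mul Pu unitmx_inv Tu; split=> // X sX.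
apply: (can_inj (mulKmx Tu)); rewrite !mulmxA rT // mulmxV // mul1mx mulmxK //.
exact: rP.
Qed.

Lemma eigengrading_compatible (F : numFieldType) n m (g : 'M[F]_n -> 'M[F]_n)
    (r : 'M[F]_n -> 'M[F]_m) (T : 'M_m) :
    T *m T = 1%:M -> (forall X, in_sl X -> T *m r (g X) = r X *m T) ->
  is_rep r -> grading_compatible g r.
Proof.
move=> TT rT [rl _]; have S : T^T *m T^T = 1%:M by rewrite -trmx_mul TT trmx1.
have rS X : in_sl X -> (r (g X))^T *m T^T = T^T *m (r X)^T.
  by move=> sX; rewrite -!trmx_mul rT.
have r0 : r 0 = 0.
  have sl0 : in_sl (0 : 'M[F]_n) by apply: linear0.
  by apply: (addrI (r 0)); rewrite addr0 -{1}[r 0]scale1r -rl // scale1r addr0.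
have rN X : in_sl X -> r (- X) = - r X.
  move=> sX; have sl0 : in_sl (0 : 'M[F]_n) by apply: linear0.
  by rewrite -[- X]addr0 -scaleN1r rl // r0 addr0 scaleN1r.
(* The eigenspaces of [T] for 1 and -1, as images of twice the spectral projections, transposed to
   match the row encoding. *)
exists (1%:M + T^T), (1%:M - T^T); split.
- apply/eqmxP; rewrite submx1 /=.
  have two : (1%:M + T^T) + (1%:M - T^T) = 2%:R *: (1%:M : 'M[F]_m).
    by rewrite addrACA subrr addr0 scaler_nat mulr2n.
  apply: submx_trans (addmx_sub_adds (submx_refl _) (submx_refl _)).
  by rewrite two eqmx_scale ?pnatr_eq0.
- apply/mxdirect_addsP/eqP; rewrite -submx0; apply/rV_subP => u.
  rewrite sub_capmx => /andP[/submxP[a ua] /submxP[b ub]].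
  have uT : u *m T^T = u by rewrite ua -mulmxA mulmxDl S mul1mx addrC.
  have uTN : u *m T^T = - u.
    by rewrite ub -mulmxA mulmxBl S mul1mx -mulmxN opprB.
  have : 2%:R *: u = 0 by rewrite scaler_nat mulr2n -{1}uT uTN addNr.
  by move/eqP; rewrite scaler_eq0 pnatr_eq0 /= submx0.
- move=> X [sX gX]; have := rS X sX; rewrite gX /maps_into => rTX.
  by rewrite !(mulmxDl, mulmxBl) !mulNmx -rTX mul1mx -{1 3}[(r X)^T]mulmx1
    -mulmxDr -mulmxBr !submxMl.
move=> X [sX gX]; have := rS X sX; rewrite gX rN // linearN /= mulNmx => rTX.
rewrite /maps_into !(mulmxDl, mulmxBl) !mulNmx -rTX mul1mx opprK.
by rewrite -{1 3}[(r X)^T]mulmx1 -mulmxDr -mulmxBr !submxMl.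
Qed.

(** As [g] is an involution, [T *m T] commutes with [r] and is a nonzero scalar; dividing [T] by its
    square root gives an involution. *)
Lemma twist_equiv_grading (C : numClosedFieldType) n m (g : 'M[C]_n -> 'M[C]_n)
    (r : 'M[C]_n -> 'M[C]_m) :
    irreducible_rep r -> lie_aut g -> (forall X, in_sl X -> g (g X) = X) ->
  rep_equiv (r \o g) r -> grading_compatible g r.
Proof.
move=> [rP m0 rs] [gs _ _ _] gg [T [Tu rT]].
have [a /= aT] := eigenvalue_closed (T *m T)^T m0.
have cT X : in_sl X -> T *m T *m r X = r X *m (T *m T).
  move=> sX; have := rT _ (gs _ sX); rewrite /= gg // => rTg.
  by rewrite -mulmxA rTg mulmxA rT // mulmxA.
have Ta : T *m T = a%:M.
  pose U := kermx ((T *m T)^T - a%:M).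
  have [X sX|/eqP|rU] := rs U; last 2 first.
  - rewrite mxrank_eq0 => /eqP U0.
    by rewrite /eigenvalue /eigenspace -/U U0 eqxx in aT.
  - have /row_full_kermx/eqP : row_full U by apply/eqP.
    by rewrite subr_eq0 => /eqP /(congr1 trmx); rewrite trmxK tr_scalar_mx.
  rewrite /maps_into sub_kermx -mulmxA mulmxBr -trmx_mul cT // trmx_mul.
  by rewrite scalar_mxC -mulmxBl mulmxA mulmx_ker mul0mx.
have a0 : a != 0.
  apply/eqP => a0; move: (Tu) m0; rewrite -[in T \in _](mulKmx Tu T) Ta a0 raddf0.
  by rewrite mulmx0 -row_free_unit /row_free mxrank0 => /eqP <-.
apply: (@eigengrading_compatible _ _ _ _ _ ((sqrtC a)^-1 *: T)) => // [|X sX].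
  rewrite -scalemxAl -scalemxAr Ta !scale_scalar_mx mulrA -invfM -expr2 sqrtCK.
  by rewrite mulVf.
by rewrite -scalemxAl rT // scalemxAr.
Qed.

(** The intertwiner [T] is 1 on [V0] and -1 on [V1]: it commutes with the image of [L0] and
    anticommutes with that of [L1]. *)
Lemma grading_twist_equiv (F : numFieldType) n m (g : 'M[F]_n -> 'M[F]_n)
    (r : 'M[F]_n -> 'M[F]_m) :
    is_rep r -> lie_aut g -> (forall X, in_sl X -> g (g X) = X) ->
  grading_compatible g r -> rep_equiv (r \o g) r.
Proof.
move=> [rl _] [gs gl _ _] gg [V0 [V1 [V01 dV r0 r1]]].
have cap0 := mxdirect_addsP dV.
have cap0' : (V1 :&: V0 = 0)%MS by apply/eqP; rewrite -submx0 capmxC cap0.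
pose p := proj_mx V0 V1; pose q := proj_mx V1 V0; pose T := p - q.
have uV k (u : 'M[F]_(k, m)) : (u <= V0 + V1)%MS by rewrite V01 submx1.
have T0 k (u : 'M[F]_(k, m)) : (u <= V0)%MS -> u *m T = u.
  by move=> u0; rewrite mulmxBr proj_mx_id // proj_mx_0 // subr0.
have T1 k (u : 'M[F]_(k, m)) : (u <= V1)%MS -> u *m T = - u.
  by move=> u1; rewrite mulmxBr proj_mx_0 // proj_mx_id // sub0r.
have ext (A B : 'M[F]_m) : V0 *m A = V0 *m B -> V1 *m A = V1 *m B -> A = B.
  move=> A0 A1; have /sub_addsmxP[[x y] /= xy] := uV _ (1%:M).
  by rewrite -[A]mul1mx -[B]mul1mx xy !mulmxDl -!mulmxA A0 A1.
have TT : T *m T = 1%:M.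
  apply: ext; rewrite mulmxA mulmx1; first by rewrite !T0.
  by rewrite (T1 _ V1) // mulNmx T1 // opprK.
have Tu : T \in unitmx by case: (mulmx1_unit TT).
have TL0 X : L0 g X -> T *m (r X)^T = (r X)^T *m T.
  move=> /r0 [m0 m1]; apply: ext; rewrite !mulmxA.
    by rewrite (T0 _ V0) // T0.
  by rewrite (T1 _ V1) // T1 // mulNmx.
have TL1 X : L1 g X -> T *m (r X)^T = - (r X)^T *m T.
  move=> /r1 [m0 m1]; apply: ext; rewrite !mulmxA mulmxN mulNmx.
    by rewrite (T0 _ V0) // T1 // opprK.
  by rewrite (T1 _ V1) // T0 // mulNmx.
have gr X : in_sl X -> T *m (r X)^T = (r (g X))^T *m T.
  move=> sX; have sgX := gs _ sX.
  (* The cases [a = 1] and [a = -1] give the components of [2 X] in [L0] and [L1]. *)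
  have gD a : g (a *: g X + X) = a *: X + g X by rewrite gl // gg.
  have sD a : in_sl (a *: g X + X).
    by rewrite /in_sl linearP /= sX sgX mulr0 addr0.
  have /TL0 TD : L0 g (1 *: g X + X) by split=> //; rewrite gD !scale1r addrC.
  have /TL1 TB : L1 g ((-1) *: g X + X).
    by split=> //; rewrite gD !scaleN1r opprD opprK addrC.
  have two0 : (2%:R : F) != 0 by rewrite pnatr_eq0.
  have rD a : (r (a *: g X + X))^T = a *: (r (g X))^T + (r X)^T.
    by rewrite rl // linearP.
  apply: (scalerI two0); rewrite !scaler_nat !mulr2n; move: TD TB.
  rewrite !rD scale1r scaleN1r; set A := (r X)^T; set B := (r (g X))^T => TD TB.
  rewrite -mulmxDr -mulmxDl.
  have -> : A + A = (B + A) + (- B + A) by rewrite addrACA subrr add0r.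
  by rewrite mulmxDr TD TB -mulmxDl opprD opprK addrACA subrr addr0.
exists T^T; rewrite unitmx_tr; split=> // X sX.
by apply: trmx_inj; rewrite !trmx_mul trmxK gr.
Qed.

Lemma grading_iff_self_contragredient (C : numClosedFieldType) n m
    (g : 'M[C]_n -> 'M[C]_n) (r : 'M[C]_n -> 'M[C]_m) :
    (3 <= n)%N -> outer_aut_order2 g -> irreducible_rep r ->
  grading_compatible g r <-> self_contragredient r.
Proof.
move=> n3 [ga go gg _] rI; have [rP _ _] := rI.
rewrite -(twist_equiv_self_contragredient (outer_twist_contragredient n3 ga go rI)).
by split; [apply: grading_twist_equiv | apply: twist_equiv_grading].
Qed.

Theorem theorem3 (R : realType) (n : nat) (hn : (3 <= n)%N)
    (g : 'M[R[i]]_n -> 'M[R[i]]_n) (hg : outer_aut_order2 g)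
    (m : nat) (r : 'M[R[i]]_n -> 'M[R[i]]_m) (hr : irreducible_rep r) :
  grading_compatible g r <-> self_contragredient r.
Proof. exact: grading_iff_self_contragredient. Qed.
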